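(* For all integers $T,p,R\ge1$, \[ \gamma_2(\mathcal S^{Tp-1},\|\cdot\|_\ominus)\lesssim\sqrt{T\tilde p},\qquad\text{where }\tilde p:=p\min\{T,\log^2(eTp)\log^2(eT)\}, \] with $\mathcal S^{Tp-1}$ the unit Euclidean sphere of $\mathbb R^{Tp}$.
   Context: For $\bar v=[v_1^\top,\dots,v_T^\top]^\top\in\mathbb R^{Tp}$ ($v_i\in\mathbb R^p$) and $R\ge1$, let $\mathsf{Toep}_T(\bar v)$ be the $R\times(R+T-1)$ block matrix with $1\times p$ blocks whose $i$-th block row has $v_T^\top,v_{T-1}^\top,\dots,v_1^\top$ in block columns $i,i+1,\dots,i+T-1$ and zeros elsewhere (so the $k$-th block superdiagonal equals $v_{T-k}^\top$, $0\le k\le T-1$). Define the norm $\|\bar v\|_\ominus:=\|\mathsf{Toep}_T(\bar v)\|_{\mathrm{op}}$. Talagrand's functional: $\gamma_2(\mathcal X,\mathsf d):=\inf_{(\mathcal A_n)}\sup_{x\in\mathcal X}\sum_{n\ge0}2^{n/2}\mathsf{diam}(\mathcal A_n(x))$ over partition sequences with $|\mathcal A_0|=1$, $|\mathcal A_n|\le2^{2^n}$. $\lesssim$ hides a universal constant. *)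

(* Defs.v *)
From HB Require Import structures.
From mathcomp Require Import all_boot all_order all_algebra.
From mathcomp Require Import all_classical all_reals all_analysis.
Set Implicit Arguments. Unset Strict Implicit. Unset Printing Implicit Defensive.
Import Order.TTheory GRing.Theory Num.Theory.
Local Open Scope classical_set_scope.
Local Open Scope ring_scope.

Section Defs.
Variable R : realType.

Definition enorm n (x : 'rV[R]_n) : R := Num.sqrt (\sum_i x 0 i ^+ 2).

Definition opnorm m n (A : 'M[R]_(m, n)) : R :=
  sup [set enorm (A *m x)^T | x in [set x : 'cV[R]_n | enorm x^T <= 1]].

(* k-th coordinate (0-indexed) of a vector, 0 out of range. *)
Definition vat n (v : 'rV[R]_n) (k : nat) : R :=
  odflt 0 (omap (fun i : 'I_n => v 0 i) (insub k)).

(* vbar = [v_1^T, ..., v_T^T]^T in R^{Tp}: coordinate j (0-indexed) of block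
   v_m (1-indexed) is coordinate (m-1)*p + j of vbar.
   Toep_T(vbar) is the nR x (nR+T-1) block matrix with 1 x p blocks whose
   i-th block row carries v_T, ..., v_1 in block columns i, ..., i+T-1;
   as a real matrix it is nR x ((nR+T-1)*p); column k lies in block column
   k %/ p, coordinate k %% p.  All indices below are 0-indexed: block (i,c)
   is v_{T-(c-i)} when i <= c < i+T, i.e. the block at offset (T-1-(c-i))*p. *)
Definition Toep (T p nR : nat) (v : 'rV[R]_(T * p)) : 'M[R]_(nR, (nR + T - 1) * p) :=
  \matrix_(i < nR, k < (nR + T - 1) * p)
    let c := (k %/ p)%N in let j := (k %% p)%N in
    if ((i <= c) && (c < i + T))%N then vat v ((T - 1 - (c - i)) * p + j)%N
    else 0.

Definition toepnorm (T p nR : nat) (v : 'rV[R]_(T * p)) : R := opnorm (Toep nR v).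

Definition sphere n : set 'rV[R]_n := [set x | enorm x = 1].

Section Gamma2.
Variables (V : Type) (d : V -> V -> R).

Definition is_partition (X : set V) (P : set (set V)) : Prop :=
  [/\ forall C, P C -> C !=set0 /\ C `<=` X,
      forall C D, P C -> P D -> C `&` D !=set0 -> C = D
    & forall x, X x -> exists2 C, P C & C x].

(* A(x): the (unique) cell of the partition P containing x. *)
Definition cell (P : set (set V)) (x : V) : set V :=
  \bigcup_(C in [set C | P C /\ C x]) C.

Definition diam (A : set V) : \bar R :=
  ereal_sup [set (d x y)%:E | x in A & y in A].

Definition admissible (X : set V) (A : nat -> set (set V)) : Prop :=
  (forall n, is_partition X (A n)) /\
  (A 0%N #<= `I_1)%card /\ (forall n, (A n #<= `I_(2 ^ (2 ^ n)))%card).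

Definition gamma2 (X : set V) : \bar R :=
  ereal_inf [set ereal_sup
     [set (\sum_(0 <= n <oo) ((Num.sqrt (2 ^+ n : R))%:E * diam (cell (A n) x)))%E
        | x in X]
   | A in [set A | admissible X A]].
End Gamma2.

Definition ptilde (T p : nat) : R :=
  p%:R * Num.min (T%:R)
    (ln (expR 1 * (T * p)%:R) ^+ 2 * ln (expR 1 * T%:R) ^+ 2).

End Defs.

(* Main.v *)
Require Import Defs.
From HB Require Import structures.
From mathcomp Require Import all_boot all_order all_algebra.
From mathcomp Require Import all_classical all_reals all_analysis.
From mathcomp Require Import ring lra zify.
Set Implicit Arguments. Unset Strict Implicit. Unset Printing Implicit Defensive.
Import Order.TTheory GRing.Theory Num.Theory.
Local Open Scope classical_set_scope.
Local Open Scope ring_scope.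

(* Write d = T * p. The partitions of an admissible sequence need not be nested,
   so it suffices to find, for each n, a code with at most 2^(2^n) values such
   that points of the sphere with equal codes are close. Three codes are used.
   - The constant code: the norm is at most sqrt T times the Euclidean one.
   - Coordinatewise truncation to a grid. Writing the grid coordinates in unary
     costs O(2^n) bits and gives diameter O(sqrt T * d / 2^n) once 2^n >= 4 d.
   - A greedy code. Cutting the rows into groups of length T and applying a
     discrete Fourier transform of size 2 T shows that the norm is at most
     3 sqrt p times the maximum of 4 T p linear functionals of Euclidean norm at
     most sqrt T. As long as one of them exceeds e on the residual, subtracting
     a multiple of it lowers the squared residual by e^2 / T, so T / e^2 steps,
     each recorded by O(log(T p)) bits, bring all functionals below e. This
     gives diameter O(sqrt (T p log(e T p) / 2^n)).
   The first two codes alone give T sqrt p. Using the greedy code in the range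
   2 p <= 2^n <= 4 d T, which contains O(log (e T)) values of n, gives the
   bound with logarithms. *)

(** * Admissible sequences built from codes *)

Section Codes.
Variables (R : realType) (V : Type) (d : V -> V -> R).
Implicit Types (X : set V) (D : nat -> R).

(** An entropy-number condition: the fibres of [c] cut [X] into at most [N] pieces of diameter at
    most [D]. *)
Definition coded X (N : nat) (D : R) : Prop :=
  exists c : V -> nat, (forall x, X x -> (c x < N)%N) /\
    (forall x y, X x -> X y -> c x = c y -> d x y <= D).

Lemma coded_le X N N' (D D' : R) :
  (N <= N')%N -> D <= D' -> coded X N D -> coded X N' D'.
Proof.
move=> leN leD [c [cN cD]]; exists c; split=> [x /cN|x y Xx Xy cxy].
  by move=> /leq_trans; apply.
exact: le_trans (cD _ _ Xx Xy cxy) leD.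
Qed.

Definition fibers X (c : V -> nat) : set (set V) :=
  [set C | exists2 x, X x & C = [set y | X y /\ c y = c x]].

Lemma fibers_partition X c : is_partition X (fibers X c).
Proof.
split.
- by move=> _ [x Xx ->]; split=> [|y []//]; exists x.
- move=> _ _ [x Xx ->] [y Xy ->] [z [[_ zx] [_ zy]]].
  by apply/seteqP; split=> t [Xt ct]; split=> //; rewrite ct -?zx -?zy.
- by move=> x Xx; exists [set y | X y /\ c y = c x] => //; exists x.
Qed.

Lemma card_fibers X c N : (forall x, X x -> (c x < N)%N) ->
  (fibers X c #<= `I_N)%card.
Proof.
move=> cN.
apply: card_le_trans (card_image_le (fun k => [set y | X y /\ c y = k]) `I_N).
by apply: subset_card_le => _ [x Xx ->]; exists (c x) => //=; exact: cN.
Qed.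

Lemma cell_fibers X c x y : cell (fibers X c) x y -> X y /\ c y = c x.
Proof. by move=> [_ [[z Xz ->] [_ cx]] [Xy cy]]; rewrite cy cx. Qed.

Lemma cell_fibers_refl X c x : X x -> cell (fibers X c) x x.
Proof.
by move=> Xx; exists [set y | X y /\ c y = c x] => //; split=> //; exists x.
Qed.

Lemma gamma2_le_coded X D (B : R) : (forall x, d x x = 0) ->
  coded X 1 (D 0%N) -> (forall n, (0 < n)%N -> coded X (2 ^ (2 ^ n)) (D n)) ->
  (forall N, \sum_(0 <= n < N) Num.sqrt (2 ^+ n) * D n <= B) ->
  (gamma2 d X <= B%:E)%E.
Proof.
move=> d0 cX0 cXS sumB.
(* Level 0 is special: a single cell is required there, whereas 2^(2^0) = 2. *)
pose N n := if n is 0%N then 1%N else (2 ^ (2 ^ n))%N.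
have /choice[c cP] : forall n, exists c : V -> nat,
    (forall x, X x -> (c x < N n)%N) /\
    (forall x y, X x -> X y -> c x = c y -> d x y <= D n).
  by case=> [|n]; [exact: cX0|exact: cXS].
apply: (@le_trans _ _ (ereal_sup
    [set (\sum_(0 <= n <oo) ((Num.sqrt (2 ^+ n : R))%:E *
            diam d (cell (fibers X (c n)) x)))%E | x in X])).
  apply: ereal_inf_lbound; exists (fun n => fibers X (c n)) => //.
  split; [|split] => [n||n]; first exact: fibers_partition.
    by apply: card_fibers; exact: (cP 0%N).1.
  apply: card_fibers => x /(cP n).1 /leq_trans; apply.
  by case: n => //= n; rewrite expn_gt0.
apply: ge_ereal_sup => _ [x Xx <-].
(* The cell contains [x] and [d x x = 0], so the series has nonnegative terms and converges;
   bounding its partial sums then suffices. *)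
have dge0 n : (0 <= diam d (cell (fibers X (c n)) x))%E.
  apply: ereal_sup_ubound; exists x; first exact: cell_fibers_refl.
  by exists x; [exact: cell_fibers_refl|rewrite d0].
have dleD n : (diam d (cell (fibers X (c n)) x) <= (D n)%:E)%E.
  apply: ge_ereal_sup => _ [y /cell_fibers[Xy cy] [z /cell_fibers[Xz cz] <-]].
  by rewrite lee_fin; apply: (cP n).2 => //; rewrite cy cz.
apply: lime_le.
  by apply: is_cvg_nneseries => n _ _; rewrite mule_ge0// lee_fin sqrtr_ge0.
near=> M.
apply: (@le_trans _ _ (\sum_(0 <= n < M) (Num.sqrt (2 ^+ n) * D n)%:E)%E).
  apply: lee_sum => n _; rewrite EFinM; apply: lee_wpmul2l; last exact: dleD.
  by rewrite lee_fin sqrtr_ge0.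
by rewrite sumEFin lee_fin.
Unshelve. all: by end_near. Qed.

End Codes.

(** * Geometric sums with ratio sqrt 2, and the three-range bound *)

Section GeometricSums.
Variable R : realType.
Local Notation s n := (Num.sqrt (2 ^+ n : R)).

Lemma sqrt2X_gt0 n : 0 < s n.
Proof. by rewrite sqrtr_gt0 exprn_gt0. Qed.

Lemma sqrt2X_neq0 n : s n != 0.
Proof. by rewrite gt_eqF// sqrt2X_gt0. Qed.

Lemma sqrt2XS n : s n.+1 = Num.sqrt 2 * s n.
Proof. by rewrite exprS sqrtrM. Qed.

Lemma sqr_sqrt2X n : s n ^+ 2 = 2 ^+ n.
Proof. by rewrite sqr_sqrtr// exprn_ge0. Qed.

(** These are exactly what the next two inductions need: 4 + 1 <= 4 sqrt 2, and 4 / sqrt 2 + 1 <=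
    4. *)
Lemma sqrt2_bounds : 5 / 4 <= Num.sqrt (2 : R) /\ 4 / 3 <= Num.sqrt (2 : R).
Proof.
have: Num.sqrt (2 : R) ^+ 2 = 2 by rewrite sqr_sqrtr.
by have : 0 <= Num.sqrt (2 : R) by []; split; nra.
Qed.

Lemma sum_sqrt2X_le N : \sum_(0 <= n < N) s n <= 4 * s N.
Proof.
elim: N => [|N IH]; first by rewrite big_geq// mulr_ge0.
rewrite big_nat_recr//= sqrt2XS.
by have := sqrt2_bounds; have := sqrt2X_gt0 N; nra.
Qed.

Lemma sum_sqrt2X_inv_le n1 N : \sum_(n1 <= n < N) (s n)^-1 <= 4 / s n1.
Proof.
case: (leqP n1 N) => [leN|ltN]; last first.
  by rewrite big_geq ?(ltnW ltN)// mulr_ge0// invr_ge0 ltW// sqrt2X_gt0.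
(* Adding a bound for the remaining tail makes the claim inductive. *)
suff: \sum_(n1 <= n < N) (s n)^-1 + 4 / s N <= 4 / s n1.
  have sN : 0 < (s N)^-1 by rewrite invr_gt0 sqrt2X_gt0.
  by move=> le_s; lra.
rewrite -(subnKC leN); elim: (N - n1)%N => [|k IH].
  by rewrite addn0 big_geq// add0r.
rewrite addnS big_nat_recr ?leq_addr//= sqrt2XS invfM.
have [_ h] := sqrt2_bounds.
have h' : (Num.sqrt (2 : R))^-1 <= 3 / 4.
  rewrite -[3 / 4]invf_div lef_pV2 ?posrE//; lra.
have : 0 < (s (n1 + k))^-1 by rewrite invr_gt0 sqrt2X_gt0.
by nra.
Qed.

(* The three ranges of n: diameter U, then sqrt(2^n) * diameter <= Q, then
   2^n * diameter <= W; the first and last sums are geometric. *)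
Lemma gamma2_le_three_ranges (V : Type) (d : V -> V -> R) (X : set V)
    (n0 n1 : nat) (U Q W : R) : (forall x, d x x = 0) ->
  (0 < n0 <= n1)%N -> 0 <= U -> 0 <= Q -> 0 <= W ->
  (forall x y, X x -> X y -> d x y <= U) ->
  (forall n, (n0 <= n < n1)%N -> coded d X (2 ^ (2 ^ n)) (Q / s n)) ->
  (forall n, (n1 <= n)%N -> coded d X (2 ^ (2 ^ n)) (W / 2 ^+ n)) ->
  (gamma2 d X <= (4 * U * s n0 + (n1 - n0)%:R * Q + 4 * W / s n1)%:E)%E.
Proof.
move=> d0 /andP[n0_gt0 n01] U0 Q0 W0 dU dQ dW.
pose D n := if (n < n0)%N then U else if (n < n1)%N then Q / s n else W / 2 ^+ n.
apply: (@gamma2_le_coded _ _ _ _ D) => //.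
- by exists (fun=> 0%N); split=> // x y Xx Xy _; rewrite /D n0_gt0; exact: dU.
- move=> n n_gt0; rewrite /D; case: (ltnP n n0) => [_|n0n].
    exists (fun=> 0%N); split=> [x _|x y Xx Xy _]; first by rewrite expn_gt0.
    exact: dU.
  by case: (ltnP n n1) => nn1; [apply: dQ; rewrite n0n|exact: dW].
move=> N; have DN : \sum_(0 <= n < N) s n * D n <=
    \sum_(0 <= n < n1 + N) s n * D n.
  rewrite [leRHS](@big_cat_nat _ _ _ N)//= ?leq_addl// lerDl sumr_ge0// => n _.
  rewrite mulr_ge0// /D; case: ifP => // _; case: ifP => _.
    by rewrite mulr_ge0// invr_ge0.
  by rewrite mulr_ge0// invr_ge0 exprn_ge0.
apply: (le_trans DN).
rewrite (@big_cat_nat _ _ _ n1)//= ?leq_addr// (@big_cat_nat _ _ _ n0)//=.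
apply: lerD; first apply: lerD.
- rewrite (eq_big_nat _ _ (F2 := fun n => U * s n)); last first.
    by move=> n /andP[_ nn0]; rewrite /D nn0 mulrC.
  by rewrite -mulr_sumr [4 * U]mulrC -mulrA ler_wpM2l// sum_sqrt2X_le.
- rewrite (eq_big_nat _ _ (F2 := fun n => Q)); last first.
    move=> n /andP[n0n nn1]; rewrite /D ltnNge n0n/= nn1.
    by rewrite mulrCA divff ?mulr1// sqrt2X_neq0.
  by rewrite sumr_const_nat mulr_natl.
- rewrite (eq_big_nat _ _ (F2 := fun n => W * (s n)^-1)); last first.
    move=> n /andP[n1n _]; rewrite /D !ltnNge (leq_trans n01 n1n) n1n/=.
    have -> : 2 ^+ n = s n * s n :> R by rewrite -expr2 sqr_sqrt2X.
    rewrite -expr2 sqrtr_sqr ger0_norm// expr2 invfM mulrCA.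
    by rewrite mulVKf ?sqrt2X_neq0.
  rewrite -mulr_sumr [4 * W]mulrC -mulrA ler_wpM2l//; exact: sum_sqrt2X_inv_le.
Qed.

End GeometricSums.

(** * Codes with values in a finite set *)

Section FiniteCodes.
Variables (R : realType) (V : Type) (dist : V -> V -> R).

Lemma coded_finset (X : set V) (K : finType) (S : {set K}) (c : V -> K) (D : R) :
  (forall x, X x -> c x \in S) ->
  (forall x y, X x -> X y -> c x = c y -> dist x y <= D) ->
  coded dist X #|S| D.
Proof.
move=> cS cD; exists (fun x => index (c x) (enum S)); split=> [x Xx|x y Xx Xy cxy].
  by rewrite cardE index_mem mem_enum cS.
apply: cD => //; rewrite -[LHS](nth_index (c x) (s := enum S)) ?mem_enum ?cS//.
by rewrite cxy nth_index// mem_enum cS.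
Qed.

End FiniteCodes.

(** * Greedy approximation against finitely many functionals *)

Section Greedy.
Variables (R : realType) (d : nat).
Implicit Types x y z : 'rV[R]_d.

Definition dot x y : R := \sum_i x 0 i * y 0 i.

Lemma dotC x y : dot x y = dot y x.
Proof. by apply: eq_bigr => i _; rewrite mulrC. Qed.

Lemma dotBr x y z : dot x (y - z) = dot x y - dot x z.
Proof. by rewrite -sumrB; apply: eq_bigr => i _; rewrite !mxE mulrBr. Qed.

Lemma dotZr (a : R) x y : dot x (a *: y) = a * dot x y.
Proof. by rewrite mulr_sumr; apply: eq_bigr => i _; rewrite !mxE mulrCA. Qed.

Lemma dotBl x y z : dot (x - y) z = dot x z - dot y z.
Proof. by rewrite dotC dotBr ![dot z _]dotC. Qed.

Lemma dotZl (a : R) x y : dot (a *: x) y = a * dot x y.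
Proof. by rewrite dotC dotZr dotC. Qed.

Lemma dotxx_ge0 x : 0 <= dot x x.
Proof. by apply: sumr_ge0 => i _; rewrite -expr2 sqr_ge0. Qed.

Lemma dotxx_eq0 x : dot x x = 0 -> x = 0.
Proof.
move=> xx0; apply/rowP => i; rewrite mxE; apply/eqP; rewrite -sqrf_eq0 expr2.
rewrite (psumr_eq0P _ xx0)// => j _.
by rewrite -expr2 sqr_ge0.
Qed.

Variables (I : finType) (f : I -> 'rV[R]_d) (L e : R).
Hypotheses (L_gt0 : 0 < L) (e_gt0 : 0 < e) (fL : forall i, dot (f i) (f i) <= L).

Definition greedy_step (o : option (I * bool)) : 'rV[R]_d :=
  if o is Some (i, b) then (e / L) *: ((-1) ^+ b *: f i) else 0.

Definition greedy_decode (s : seq (option (I * bool))) : 'rV[R]_d :=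
  \sum_(o <- s) greedy_step o.

(* Whenever some functional f i still sees more than e of the residual, removing
   a multiple of f i lowers the squared norm of the residual by e^2 / L. *)
Lemma greedy_approx (m : nat) x : dot x x <= m%:R * (e ^+ 2 / L) ->
  exists s : m.-tuple (option (I * bool)),
    forall i, `|dot (f i) (x - greedy_decode s)| <= e.
Proof.
elim: m x => [|m IH] x xm.
  exists [tuple] => i; have /dotxx_eq0 -> : dot x x = 0.
    by apply/eqP; rewrite eq_le dotxx_ge0 andbT; rewrite mul0r in xm.
  rewrite /greedy_decode big_nil subrr /dot big1 ?normr0 ?ltW// => j _.
  by rewrite mxE mulr0.
have [small|/existsP[i]] := boolP [forall i, `|dot (f i) x| <= e].
  (* Stopping early is padded with [None], which decodes to 0, so that all words have the same
     length. *)
  exists (nseq_tuple m.+1 None) => i; rewrite /greedy_decode big1_seq ?subr0.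
    by move/forallP: small; apply.
  by move=> o /andP[_ /nseqP[-> _]].
(* [b] records the sign, so the step always moves towards the origin along [f i]. *)
rewrite -ltNge => big; pose b := dot (f i) x < 0.
have bE : (-1) ^+ b * dot (f i) x = `|dot (f i) x|.
  rewrite /b; case: ltP => [/ltr0_norm->|/ger0_norm->].
    by rewrite expr1 mulN1r.
  by rewrite expr0 mul1r.
have [|s sP] := IH (x - greedy_step (Some (i, b))).
  have -> : dot (x - greedy_step (Some (i, b))) (x - greedy_step (Some (i, b))) =
      dot x x - 2 * (e / L) * `|dot (f i) x| + (e / L) ^+ 2 * dot (f i) (f i).
    rewrite dotBr !dotBl (dotC x (greedy_step _)) /= !dotZl !dotZr -bE.
    rewrite (_ : (e / L) ^+ 2 = (e / L) ^+ 2 * ((-1) ^+ b * (-1) ^+ b)).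
      by ring.
    by rewrite -expr2 sqrr_sign mulr1.
  have eL : 0 < e / L by rewrite divr_gt0.
  have e2L : e ^+ 2 / L = (e / L) * e by field; rewrite gt_eqF.
  have : (e / L) ^+ 2 * dot (f i) (f i) <= (e / L) * e.
    rewrite (_ : e / L * e = (e / L) ^+ 2 * L); last by field; rewrite gt_eqF.
    by rewrite ler_wpM2l// sqr_ge0.
  have : (e / L) * e <= (e / L) * `|dot (f i) x| by rewrite ler_pM2l// ltW.
  move: xm; rewrite -natr1 e2L; nra.
exists [tuple of Some (i, b) :: s] => j.
have -> : greedy_decode [tuple of Some (i, b) :: s] =
    greedy_step (Some (i, b)) + greedy_decode s by rewrite /greedy_decode big_cons.
by rewrite opprD addrA; exact: sP.
Qed.

(** Points with the same word differ exactly by the difference of their residuals, hence the factor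
    2. The alphabet consists of signed indices and [None]. *)
Lemma greedy_coded (dist : 'rV[R]_d -> 'rV[R]_d -> R) (X : set 'rV[R]_d)
    (m : nat) (D : R) :
  (forall x, X x -> dot x x <= m%:R * (e ^+ 2 / L)) ->
  (forall x y, X x -> X y ->
     (forall i, `|dot (f i) (x - y)| <= 2 * e) -> dist x y <= D) ->
  coded dist X ((#|I| * 2).+1 ^ m) D.
Proof.
move=> Xm distD.
pose K : finType := m.-tuple (option (I * bool)).
have /choice[c cP] : forall x, exists s : K,
    X x -> forall i, `|dot (f i) (x - greedy_decode s)| <= e.
  move=> x; have [Xx|nXx] := pselect (X x); last by exists (nseq_tuple m None).
  by have [s sP] := greedy_approx (Xm x Xx); exists s.
have -> : ((#|I| * 2).+1 ^ m)%N = #|[set: K]%SET|.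
  by rewrite cardsT card_tuple card_option card_prod card_bool.
apply: (@coded_finset _ _ _ _ _ _ c) => [x _|x y Xx Xy cxy]; first by rewrite inE.
apply: distD => // i.
have -> : x - y = (x - greedy_decode (c x)) - (y - greedy_decode (c y)).
  by rewrite cxy opprB addrA subrK.
rewrite dotBr; apply: (le_trans (ler_normB _ _)).
by have := cP x Xx i; have := cP y Xy i; lra.
Qed.

End Greedy.

(** * Truncation to a grid and counting of unary codes *)

Section Truncation.
Variables (R : realType) (d : nat).

Lemma sum_half_expr_le n : \sum_(0 <= a < n) (2^-1 : R) ^+ a <= 2.
Proof.
suff : \sum_(0 <= a < n) (2^-1 : R) ^+ a + 2 * 2^-1 ^+ n <= 2.
  by apply: le_trans; rewrite lerDl mulr_ge0// exprn_ge0// invr_ge0.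
elim: n => [|n IH]; first by rewrite big_geq// expr0; lra.
by rewrite big_nat_recr//= exprS; lra.
Qed.

(** Per coordinate, a sign and a number of grid steps; the total number of steps is the unary
    length. *)
Definition short_codes (K : nat) : {set {ffun 'I_d -> bool * 'I_K.+1}} :=
  [set g : {ffun 'I_d -> bool * 'I_K.+1} | (\sum_i (g i).2 <= K)%N]%SET.

(* Each code g is given the weight 2^(-sum_i (g i).2), and the total weight of
   all codes is a product over the d coordinates. *)
Lemma card_short_codes K : (#|short_codes K| <= 2 ^ (K + 2 * d))%N.
Proof.
rewrite -(ler_nat R) -sum1_card natr_sum.
pose wt (u : bool * 'I_K.+1) : R := 2^-1 ^+ u.2.
have wt_ge0 u : 0 <= wt u by rewrite exprn_ge0// invr_ge0.
apply: (@le_trans _ _ (2 ^+ K *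
    \sum_(g : {ffun 'I_d -> bool * 'I_K.+1}) \prod_i wt (g i))).
  rewrite mulr_sumr [leRHS](bigID (mem (short_codes K)))/=.
  rewrite -[leLHS]addr0; apply: lerD.
    apply: ler_sum => g; rewrite inE => gK.
    rewrite /wt prodrXr exprVn ler_pdivlMr ?exprn_gt0// mul1r.
    by rewrite ler_eXn2l// ltr1n.
  by apply: sumr_ge0 => g _; rewrite mulr_ge0 ?exprn_ge0 ?prodr_ge0.
rewrite -(bigA_distr_bigA (fun _ u => wt u))/= prodr_const card_ord.
(* Two signs times a geometric sum at most 2 give a factor 2^2 per coordinate, the source of the
   exponent [2 * d]. *)
have -> : \sum_j wt j = 2 * \sum_(0 <= a < K.+1) 2^-1 ^+ a.
  rewrite big_mkord -(pair_bigA _ (fun b a => wt (b, a)))/= big_bool/= /wt/=.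
  by rewrite mulr_natl mulr2n.
rewrite natrX exprD ler_wpM2l ?exprn_ge0// exprM.
apply: lerXn2r; rewrite ?nnegrE ?exprn_ge0//.
  by rewrite mulr_ge0// sumr_ge0// => a _; rewrite exprn_ge0// invr_ge0.
by rewrite expr2 ler_wpM2l// sum_half_expr_le.
Qed.

(** Rounding absolute values down keeps the total number of steps within the l1 budget [K]; the sign
    is stored because both sides of 0 round to 0. *)
Lemma truncation_coded (dist : 'rV[R]_d -> 'rV[R]_d -> R) (X : set 'rV[R]_d)
    (K : nat) (delta D : R) : 0 < delta ->
  (forall x, X x -> \sum_i `|x 0 i| <= K%:R * delta) ->
  (forall x y, X x -> X y ->
     (forall i, `|x 0 i - y 0 i| <= delta) -> dist x y <= D) ->
  coded dist X (2 ^ (K + 2 * d)) D.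
Proof.
move=> delta_gt0 XK distD.
pose t (x : 'rV[R]_d) i := Num.trunc (`|x 0 i| / delta).
have tP x i : (t x i)%:R * delta <= `|x 0 i| < (t x i).+1%:R * delta.
  have /truncn_itv/andP[tl tr] : 0 <= `|x 0 i| / delta by rewrite divr_ge0// ltW.
  by rewrite -ler_pdivlMr// tl -ltr_pdivrMr.
have sum_t x : X x -> (\sum_i t x i <= K)%N.
  move=> /XK xK; rewrite -(ler_nat R) natr_sum -(ler_pM2r delta_gt0) mulr_suml.
  by apply: le_trans xK; apply: ler_sum => i _; have /andP[] := tP x i.
pose c (x : 'rV[R]_d) : {ffun 'I_d -> bool * 'I_K.+1} :=
  [ffun i => (x 0 i < 0, inord (t x i))].
have cE x i : X x -> ((c x i).2 = t x i :> nat).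
  move=> /sum_t tK; rewrite ffunE inordK// ltnS (leq_trans _ tK)//.
  by rewrite (bigD1 i)//= leq_addr.
apply: coded_le (card_short_codes K) (lexx D) _.
apply: (@coded_finset _ _ _ _ _ _ c) => [x Xx|x y Xx Xy cxy].
  by rewrite inE (eq_bigr (t x)) ?sum_t// => i _; exact: cE.
apply: distD => // i.
have txy : t x i = t y i by rewrite -!cE// cxy.
have /(congr1 fst) : c x i = c y i by rewrite cxy.
rewrite !ffunE/=; have := tP x i; have := tP y i; rewrite txy -natr1.
case: (ltP (x 0 i) 0) => x0; case: (ltP (y 0 i) 0) => y0 // + + _.
  rewrite (ltr0_norm x0) (ltr0_norm y0) => /andP[? ?] /andP[? ?]; rewrite ler_norml; lra.
rewrite (ger0_norm x0) (ger0_norm y0) => /andP[? ?] /andP[? ?]; rewrite ler_norml; lra.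
Qed.

End Truncation.

(** * Discrete Fourier transform of size 2T in real form *)

Section Fourier.
Variable R : realType.

(** The Dirichlet kernel: 2 sin t cos(2mt) = sin((2m+1)t) - sin((2m-1)t) telescopes. *)
Lemma sin_mul_sum_cos (t : R) (n : nat) :
  2 * sin t * \sum_(0 <= m < n) cos (m%:R * (2 * t)) =
  sin (n%:R * (2 * t) - t) + sin t.
Proof.
elim: n => [|n IH]; first by rewrite big_geq// mulr0 mul0r sub0r sinN addNr.
rewrite big_nat_recr//= mulrDr IH.
have -> : n.+1%:R * (2 * t) - t = n%:R * (2 * t) + t by rewrite -[n.+1%:R]natr1; ring.
by rewrite sinB sinD; ring.
Qed.

Variable T : nat.
Hypothesis T_gt0 : (0 < T)%N.

(** The angle 2 pi m c / (2T) of the character of frequency [m] on the cyclic group of order 2T. *)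
Definition phase (m c : nat) : R := m%:R * (pi * c%:R / T%:R).
Local Notation co m c := (cos (phase m c)).
Local Notation si m c := (sin (phase m c)).

Lemma sum_cos_phase (a : nat) : (0 < a < 2 * T)%N ->
  \sum_(0 <= m < 2 * T) co m a = 0.
Proof.
move=> /andP[a0 aT]; pose t : R := pi * a%:R / (2 * T)%:R.
have T0 : (0 : R) < T%:R by rewrite ltr0n.
have tE : 2 * t = pi * a%:R / T%:R by rewrite /t natrM; field; rewrite gt_eqF.
have st : 0 < sin t.
  apply: sin_gt0_pi; rewrite /t divr_gt0 ?mulr_gt0 ?pi_gt0 ?ltr0n ?muln_gt0//=.
  rewrite ltr_pdivrMr ?ltr0n ?muln_gt0// ltr_pM2l ?pi_gt0//.
  by rewrite ltr_nat.
have := sin_mul_sum_cos t (2 * T).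
have -> : (2 * T)%:R * (2 * t) - t = - t + pi *+ 2 *+ a.
  have -> : pi *+ 2 *+ a = pi * 2 * a%:R :> R by rewrite !mulr_natr.
  by rewrite /t natrM; field; rewrite gt_eqF.
rewrite (periodicn (@sinD2pi R)) sinN addNr => /eqP.
rewrite mulf_eq0 mulf_eq0 pnatr_eq0 (gt_eqF st)/= tE => /eqP.
by [].
Qed.

Lemma phase_orthogonal (a b : nat) : (a < 2 * T)%N -> (b < 2 * T)%N ->
  \sum_(0 <= m < 2 * T) (co m a * co m b + si m a * si m b) =
  (2 * T)%:R * (a == b)%:R.
Proof.
move=> aT bT; wlog ba : a b aT bT / (b <= a)%N => [wl|].
  case/orP: (leq_total a b) => h; last exact: wl.
  rewrite eq_sym -wl//; apply: eq_bigr => m _; by rewrite mulrC [X in _ + X]mulrC.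
under eq_bigr do rewrite -cosB.
have phB m : phase m a - phase m b = phase m (a - b).
  by rewrite /phase natrB//; ring.
under eq_bigr do rewrite phB.
have [->|neq] := eqVneq a b.
  rewrite subnn (eq_bigr (fun=> 1)); last by move=> m _; rewrite /phase mulr0 mul0r mulr0 cos0.
  by rewrite sumr_const_nat subn0 mulr1.
rewrite mulr0 sum_cos_phase// subn_gt0 ltn_neqAle eq_sym neq ba/=.
by rewrite (leq_ltn_trans (leq_subr _ _)).
Qed.

Implicit Types x y w : nat -> R.
Definition cosT x n m : R := \sum_(0 <= c < n) x c * co m c.
Definition sinT x n m : R := \sum_(0 <= c < n) x c * si m c.

Lemma parseval x n : (n <= 2 * T)%N ->
  \sum_(0 <= m < 2 * T) (cosT x n m ^+ 2 + sinT x n m ^+ 2) =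
  (2 * T)%:R * \sum_(0 <= c < n) x c ^+ 2.
Proof.
move=> nT.
transitivity (\sum_(0 <= m < 2 * T) \sum_(0 <= c < n) \sum_(0 <= e < n)
    x c * x e * (co m c * co m e + si m c * si m e)).
  apply: eq_bigr => m _; rewrite /cosT /sinT !expr2 !mulr_suml -big_split/=.
  apply: eq_bigr => c _; rewrite !mulr_sumr -big_split/=.
  by apply: eq_bigr => e _; ring.
rewrite exchange_big/= mulr_sumr; apply: eq_big_nat => c /andP[_ cn].
rewrite exchange_big/= (bigD1_seq c) ?mem_index_iota ?iota_uniq//=.
rewrite -mulr_sumr phase_orthogonal ?(leq_trans cn)// eqxx mulr1.
rewrite big_seq_cond big1 ?addr0; first by rewrite expr2; ring.
move=> e; rewrite mem_index_iota => /andP[/andP[_ en] ec].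
rewrite -mulr_sumr phase_orthogonal ?(leq_trans cn)// ?(leq_trans en)//.
by rewrite eq_sym (negPf ec) !mulr0.
Qed.

(** The transform turns convolution into a product. Size 2T suffices since i + k < 2T, so indices
    never wrap around. *)
Lemma convolution_phases y w x :
  (2 * T)%:R * \sum_(0 <= i < T) \sum_(0 <= k < T) y i * w k * x (i + k)%N =
  \sum_(0 <= m < 2 * T)
    (cosT x (2 * T) m * (cosT y T m * cosT w T m - sinT y T m * sinT w T m) +
     sinT x (2 * T) m * (sinT y T m * cosT w T m + cosT y T m * sinT w T m)).
Proof.
have phD m i k : phase m i + phase m k = phase m (i + k).
  by rewrite /phase natrD; ring.
transitivity (\sum_(0 <= m < 2 * T) \sum_(0 <= i < T) \sum_(0 <= k < T)
   \sum_(0 <= c < 2 * T) y i * w k * x c *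
     (co m c * co m (i + k) + si m c * si m (i + k))); last first.
  apply: eq_bigr => m _.
  have -> : cosT y T m * cosT w T m - sinT y T m * sinT w T m =
      \sum_(0 <= i < T) \sum_(0 <= k < T) y i * w k * co m (i + k).
    rewrite /cosT /sinT !mulr_suml -sumrB; apply: eq_bigr => i _.
    rewrite !mulr_sumr -sumrB; apply: eq_bigr => k _.
    by rewrite -phD cosD; ring.
  have -> : sinT y T m * cosT w T m + cosT y T m * sinT w T m =
      \sum_(0 <= i < T) \sum_(0 <= k < T) y i * w k * si m (i + k).
    rewrite /cosT /sinT !mulr_suml -big_split/=; apply: eq_bigr => i _.
    rewrite !mulr_sumr -big_split/=; apply: eq_bigr => k _.
    by rewrite -phD sinD; ring.
  rewrite !mulr_sumr -big_split/=; apply: eq_bigr => i _.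
  rewrite !mulr_sumr -big_split/=; apply: eq_bigr => k _.
  rewrite /cosT /sinT !mulr_suml -big_split/=; apply: eq_bigr => c _.
  by ring.
rewrite [RHS]exchange_big/= mulr_sumr; apply: eq_big_nat => i /andP[_ iT].
rewrite [RHS]exchange_big/= mulr_sumr; apply: eq_big_nat => k /andP[_ kT].
have ikT : (i + k < 2 * T)%N.
  by rewrite mul2n -addnn -addSn leq_add// ltnW.
rewrite exchange_big/= (bigD1_seq (i + k)%N) ?mem_index_iota ?iota_uniq//=.
rewrite -mulr_sumr phase_orthogonal// eqxx mulr1.
rewrite big_seq_cond big1 ?addr0; first by ring.
move=> c; rewrite mem_index_iota => /andP[/andP[_ cT] ec].
by rewrite -mulr_sumr phase_orthogonal// (negPf ec) !mulr0.
Qed.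

(** The transform of [w] acts as a multiplier bounded by [B] in both parts; weighted squares and
    [parseval] do the rest. *)
Lemma convolution_bound y w x (B : R) :
  (forall m, (m < 2 * T)%N -> `|cosT w T m| <= B /\ `|sinT w T m| <= B) ->
  \sum_(0 <= i < T) \sum_(0 <= k < T) y i * w k * x (i + k)%N <=
  B * (\sum_(0 <= c < 2 * T) x c ^+ 2 + \sum_(0 <= i < T) y i ^+ 2).
Proof.
move=> wB; have T2 : (0 : R) < (2 * T)%:R by rewrite ltr0n muln_gt0.
rewrite -(ler_pM2l T2) convolution_phases mulrCA mulrDr -!parseval//; last first.
  by rewrite mul2n -addnn leq_addr.
rewrite -big_split/= mulr_sumr; apply: ler_sum_nat => m /andP[_ mT].
have [] := wB _ mT.
move: (cosT x _ m) (sinT x _ m) (cosT y _ m) (sinT y _ m) => a b c e.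
move: (cosT w T m) (sinT w T m) => u v; rewrite !ler_norml.
move=> /andP[ul ur] /andP[vl vr].
(* Each of a, b, c, e occurs in two of the four products, so the halves add up to [B] times the sum
   of squares. *)
have prod_le z g h : - B <= z -> z <= B -> z * (g * h) <= B * ((g ^+ 2 + h ^+ 2) / 2).
  move=> zl zr; have : 0 <= (B - z) * (g + h) ^+ 2 by rewrite mulr_ge0 ?sqr_ge0; lra.
  have : 0 <= (B + z) * (g - h) ^+ 2 by rewrite mulr_ge0 ?sqr_ge0; lra.
  by lra.
have := prod_le _ a c ul ur; have := prod_le _ b e ul ur.
have := prod_le _ b c vl vr; have := prod_le v (- a) e vl vr.
rewrite sqrrN; lra.
Qed.

End Fourier.

(** * Bounds on the block Toeplitz norm *)

Section Toeplitz.
Variable R : realType.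

Lemma sum_nat_eq0 (F : nat -> R) a b :
  (forall k, (a <= k < b)%N -> F k = 0) -> \sum_(a <= k < b) F k = 0.
Proof. by move=> F0; rewrite big_nat_cond big1// => k /andP[/F0]. Qed.

Lemma sum_blocks (F : nat -> R) n p :
  \sum_(0 <= q < n * p) F q = \sum_(0 <= c < n) \sum_(0 <= j < p) F (c * p + j)%N.
Proof.
rewrite big_nat_mul; apply: eq_bigr => c _.
rewrite -{1}[(c * p)%N]add0n big_addn mulSn addnK.
by apply: eq_bigr => j _; rewrite addnC.
Qed.

Lemma sum_residue (g h : nat -> R) n p j : (j < p)%N ->
  \sum_(0 <= q < n * p) (if (q %% p == j)%N then g (q %/ p)%N else 0) * h q =
  \sum_(0 <= c < n) g c * h (c * p + j)%N.
Proof.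
move=> jp; rewrite sum_blocks; apply: eq_bigr => c _.
have p0 : (0 < p)%N by exact: leq_ltn_trans jp.
rewrite (bigD1_seq j) ?mem_index_iota ?iota_uniq//=.
rewrite modnMDl modn_small// eqxx divnMDl// divn_small// addn0.
rewrite big_seq_cond big1 ?addr0// => i; rewrite mem_index_iota => /andP[/andP[_ ip] ij].
by rewrite modnMDl modn_small// (negPf ij) mul0r.
Qed.

Lemma vat_ord n (v : 'rV[R]_n) (i : 'I_n) : vat v i = v 0 i.
Proof. by rewrite /vat valK. Qed.

Lemma vat_oversize n (v : 'rV[R]_n) k : (n <= k)%N -> vat v k = 0.
Proof. by move=> nk; rewrite /vat insubF// ltnNge nk. Qed.

Lemma dot_vat n (u v : 'rV[R]_n) : dot u v = \sum_(0 <= k < n) vat u k * vat v k.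
Proof. by rewrite big_mkord; apply: eq_bigr => i _; rewrite !vat_ord. Qed.

Lemma sum_vat_sqr_le n (v : 'rV[R]_n) N : \sum_(0 <= k < N) vat v k ^+ 2 <= dot v v.
Proof.
rewrite dot_vat; under [leRHS]eq_bigr do rewrite -expr2.
have [Nn|nN] := leqP N n.
  by rewrite [leRHS](@big_cat_nat _ _ _ N)//= lerDl sumr_ge0// => k _; rewrite sqr_ge0.
rewrite (@big_cat_nat _ _ _ n)//= ?(ltnW nN)// [X in _ + X]sum_nat_eq0 ?addr0//.
by move=> k /andP[nk _]; rewrite vat_oversize// expr0n.
Qed.

Lemma enormE n (v : 'rV[R]_n) : enorm v = Num.sqrt (dot v v).
Proof. by []. Qed.

Lemma opnorm_le m n (A : 'M[R]_(m, n)) (B : R) : 0 <= B ->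
  (forall x : 'cV[R]_n, dot x^T x^T <= 1 ->
     dot (A *m x)^T (A *m x)^T <= B ^+ 2) -> opnorm A <= B.
Proof.
move=> B0 AB; apply: ge_sup.
  exists (enorm (A *m 0)^T); exists 0 => //=.
  by rewrite enormE trmx0 /dot big1 ?sqrtr0// => i _; rewrite mxE mul0r.
move=> _ [x /= x1 <-]; rewrite enormE -[B]ger0_norm// -sqrtr_sqr ler_wsqrtr//.
apply: AB; rewrite -(@sqr_sqrtr _ (dot x^T x^T)) ?dotxx_ge0// -enormE.
by rewrite exprn_ile1 ?sqrtr_ge0.
Qed.

Lemma toepnorm0 (T p nR : nat) : toepnorm nR (0 : 'rV[R]_(T * p)) = 0.
Proof.
have Toep0 : Toep nR (0 : 'rV[R]_(T * p)) = 0.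
  apply/matrixP => i k; rewrite !mxE/=; case: ifP => // _.
  by rewrite /vat; case: insub => //= q; rewrite mxE.
rewrite /toepnorm /opnorm Toep0 -[RHS]sup1; congr sup.
have e0 : enorm (0 : 'rV[R]_nR) = 0.
  by rewrite /enorm big1 ?sqrtr0// => i _; rewrite mxE expr0n.
apply/seteqP; split=> [_ [x _ <-]|_ ->]; first by rewrite mul0mx trmx0 e0.
exists 0; last by rewrite mul0mx trmx0 e0.
by rewrite /= trmx0 /enorm big1 ?sqrtr0// => i _; rewrite mxE expr0n.
Qed.

Variables T p nR : nat.
Hypotheses (T_gt0 : (0 < T)%N) (p_gt0 : (0 < p)%N).
Implicit Types (v : 'rV[R]_(T * p)) (x : 'cV[R]_((nR + T - 1) * p)).

(* The block on the k-th superdiagonal of Toep v. *)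
Definition block v (k j : nat) : R := vat v ((T - 1 - k) * p + j).

Lemma toep_row v x (i : 'I_nR) : (Toep nR v *m x) i 0 =
  \sum_(0 <= j < p) \sum_(0 <= k < T) block v k j * vat x^T ((i + k) * p + j).
Proof.
rewrite mxE (eq_bigr (fun k : 'I_((nR + T - 1) * p) =>
    (fun q : nat => (if ((i <= q %/ p) && (q %/ p < i + T))%N then
       vat v ((T - 1 - (q %/ p - i)) * p + q %% p)%N else 0) * vat x^T q) k)); last first.
  by move=> k _; rewrite vat_ord !mxE.
rewrite -(big_mkord xpredT (fun q : nat => (if ((i <= q %/ p) && (q %/ p < i + T))%N then
       vat v ((T - 1 - (q %/ p - i)) * p + q %% p)%N else 0) * vat x^T q)).
rewrite sum_blocks [RHS]exchange_big/=.
have iR := ltn_ord i.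
(* Block columns split into those before, on and after the band of row [i]; only the band
   contributes. *)
rewrite (@big_cat_nat _ _ _ i)//=; last by lia.
rewrite (@big_cat_nat _ _ _ (i + T) i)//=; try by lia.
have divE c j : (j < p)%N -> ((c * p + j) %/ p)%N = c.
  by move=> jp; rewrite divnMDl// divn_small// addn0.
have modE c j : (j < p)%N -> ((c * p + j) %% p)%N = j.
  by move=> jp; rewrite modnMDl modn_small.
rewrite [X in X + _]sum_nat_eq0 ?add0r; last first.
  move=> c /andP[_ ci]; apply: sum_nat_eq0 => j /andP[_ jp].
  by rewrite divE// leqNgt ci mul0r.
rewrite [X in _ + X]sum_nat_eq0 ?addr0; last first.
  move=> c /andP[ic _]; apply: sum_nat_eq0 => j /andP[_ jp].
  by rewrite divE// [(c < _)%N]ltnNge ic andbF mul0r.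
rewrite -{1}[nat_of_ord i]add0n big_addn addKn.
apply: eq_big_nat => k /andP[_ kT]; apply: eq_big_nat => j /andP[_ jp].
rewrite divE// modE// leq_addl [(k + i)%N]addnC ltn_add2l kT/=.
by rewrite addKn.
Qed.

(** Duality: the squared norm of the image is a sum of [p] convolution forms. The scale [t] is kept
    free for balancing, and [G] allows padding by zero rows. *)
Lemma dot_toep_row v x (G : nat) (t : R) : (nR <= G)%N ->
  t * dot (Toep nR v *m x)^T (Toep nR v *m x)^T =
  \sum_(0 <= j < p) \sum_(0 <= i < G) \sum_(0 <= k < T)
    (t * vat (Toep nR v *m x)^T i) * block v k j * vat x^T ((i + k) * p + j).
Proof.
move=> RG; rewrite exchange_big/= (@big_cat_nat _ _ _ nR)//=.
rewrite [X in _ + X]sum_nat_eq0 ?addr0; last first.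
  move=> i /andP[Ri _]; apply: big1 => j _; apply: big1 => k _.
  by rewrite vat_oversize// mulr0 !mul0r.
rewrite big_mkord /dot mulr_sumr; apply: eq_bigr => i _.
rewrite vat_ord mulrA; have {2}-> : (Toep nR v *m x)^T 0 i = (Toep nR v *m x) i 0.
  by rewrite mxE.
rewrite toep_row mulr_sumr.
apply: eq_bigr => j _; rewrite mulr_sumr; apply: eq_bigr => k _.
by rewrite mulrA.
Qed.

Lemma sum_columns_le x n :
  \sum_(0 <= j < p) \sum_(0 <= c < n) vat x^T (c * p + j) ^+ 2 <= dot x^T x^T.
Proof.
rewrite exchange_big/= -(sum_blocks (fun q => vat x^T q ^+ 2)).
exact: sum_vat_sqr_le.
Qed.

(* Cutting the rows into groups of T rows, each group only meets 2T block
   columns, and every block column is met by two groups. *)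
Lemma grouped_convolution_bound (y w u : nat -> R) (B : R) (G : nat) :
  (forall m, (m < 2 * T)%N -> `|cosT T w T m| <= B /\ `|sinT T w T m| <= B) ->
  \sum_(0 <= i < G * T) \sum_(0 <= k < T) y i * w k * u (i + k)%N <=
  B * (\sum_(0 <= c < G * T) u c ^+ 2 + \sum_(0 <= c < G.+1 * T) u c ^+ 2 +
       \sum_(0 <= i < G * T) y i ^+ 2).
Proof.
move=> wB; elim: G => [|G IH].
  rewrite mul0n !(@big_geq _ _ _ 0 0)// add0r addr0 mulr_ge0//.
    have [cB _] := wB 0%N ltac:(by rewrite muln_gt0).
    exact: le_trans cB.
  by apply: sumr_ge0 => c _; rewrite sqr_ge0.
have GT : (G * T <= G.+1 * T)%N by rewrite leq_mul2r leqnSn orbT.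
have GT2 : (G * T <= G.+2 * T)%N by rewrite leq_mul2r (leq_trans (leqnSn _)) ?orbT.
rewrite (@big_cat_nat _ _ _ (G * T))//= [X in _ <= _ * (_ + _ + X)](@big_cat_nat _ _ _ (G * T))//=.
(* The tail of this sum holds the 2T columns met by the new group; its head and the first sum swap
   roles in the induction hypothesis. *)
rewrite [X in _ <= _ * (_ + X + _)](@big_cat_nat _ _ _ (G * T))//=.
have shift F k : \sum_(G * T <= i < (k + G) * T) F i =
    \sum_(0 <= i < k * T) F (i + G * T)%N :> R.
  by rewrite -{1}[(G * T)%N]add0n big_addn mulnDl addnK.
rewrite (shift _ 1%N) (shift _ 2%N) (shift _ 1%N) mul1n.
have := convolution_bound T_gt0 (fun i => y (i + G * T)%N) (fun i => u (i + G * T)%N) wB.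
have -> : \sum_(0 <= i < T) \sum_(0 <= k < T) y (i + G * T) * w k * u (i + k + G * T)%N =
    \sum_(0 <= i < T) \sum_(0 <= k < T) y (i + G * T) * w k * u (i + G * T + k)%N.
  by apply: eq_bigr => i _; apply: eq_bigr => k _; rewrite addnAC.
move: IH; lra.
Qed.

Lemma toepnorm_le_phases v (B : R) : 0 < B ->
  (forall m j, (m < 2 * T)%N -> (j < p)%N ->
     `|cosT T (block v ^~ j) T m| <= B /\ `|sinT T (block v ^~ j) T m| <= B) ->
  toepnorm nR v <= 3 * Num.sqrt p%:R * B.
Proof.
move=> B0 vB; apply: opnorm_le => [|x x1].
  by rewrite !mulr_ge0// ltW.
set z := (Toep nR v *m x)^T; have z0 := dotxx_ge0 z.
(* With this scale the quadratic term becomes half of [dot z z] and is absorbed, leaving [dot z z]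
   at most 8 p B^2, below 9 p B^2. *)
pose t := (2 * B * p%:R)^-1.
have p0 : (0 : R) < p%:R by rewrite ltr0n.
have RG : (nR <= nR * T)%N by rewrite leq_pmulr.
have tz : t * dot z z <= B * (2 + p%:R * t ^+ 2 * dot z z).
  rewrite (dot_toep_row v x t RG).
  apply: (@le_trans _ _ (\sum_(0 <= j < p) B *
    (\sum_(0 <= c < nR * T) vat x^T (c * p + j) ^+ 2 +
     \sum_(0 <= c < nR.+1 * T) vat x^T (c * p + j) ^+ 2 +
     t ^+ 2 * dot z z))).
    apply: ler_sum_nat => j /andP[_ jp].
    have := grouped_convolution_bound (fun i => t * vat z i)
      (fun c => vat x^T (c * p + j)) nR (fun m mT => vB m j mT jp).
    move/le_trans; apply; rewrite ler_wpM2l ?(ltW B0)// lerD2l.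
    under eq_bigr do rewrite exprMn.
    by rewrite -mulr_sumr ler_wpM2l ?sqr_ge0// sum_vat_sqr_le.
  rewrite -mulr_sumr ler_wpM2l ?(ltW B0)// !big_split/= sumr_const_nat subn0.
  have := sum_columns_le x (nR * T); have := sum_columns_le x (nR.+1 * T).
  rewrite -mulr_natl; lra.
have tE : 2 * B * p%:R * t = 1 by rewrite /t divff// !mulf_neq0// gt_eqF.
rewrite !exprMn sqr_sqrtr ?ler0n//.
have : 2 * B * p%:R * (t * dot z z) <=
       2 * B * p%:R * (B * (2 + p%:R * t ^+ 2 * dot z z)).
  by rewrite ler_wpM2l// !mulr_ge0// ltW.
have -> : 2 * B * p%:R * (B * (2 + p%:R * t ^+ 2 * dot z z)) =
  4 * B ^+ 2 * p%:R + (2 * B * p%:R * t) ^+ 2 * dot z z / 2 by field.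
rewrite mulrA tE; have : 0 <= B ^+ 2 * p%:R by rewrite mulr_ge0 ?sqr_ge0.
by lra.
Qed.

Lemma sum_block_sqr v :
  \sum_(0 <= j < p) \sum_(0 <= k < T) block v k j ^+ 2 = dot v v.
Proof.
rewrite exchange_big/= big_nat_rev/= dot_vat sum_blocks.
apply: eq_big_nat => k /andP[_ kT]; apply: eq_bigr => j _.
by rewrite /block -expr2; congr (vat v (_ * p + j) ^+ 2); lia.
Qed.

(** Each entry of [x] is met at most once per superdiagonal, hence the factor [T]. A positive bound
    [W] replaces [dot v v] so that it can be divided by. *)
Lemma toepnorm_le_sqrt v (W : R) : 0 < W -> dot v v <= W ->
  toepnorm nR v <= Num.sqrt (T%:R * W).
Proof.
move=> W0 vW; apply: opnorm_le => [|x x1]; first exact: sqrtr_ge0.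
rewrite sqr_sqrtr ?mulr_ge0 ?ler0n ?(ltW W0)//.
set z := (Toep nR v *m x)^T; have z0 := dotxx_ge0 z.
suff : \sum_(0 <= j < p) \sum_(0 <= i < nR) \sum_(0 <= k < T)
    1 * vat z i * block v k j * vat x^T ((i + k) * p + j) <=
    (dot z z + T%:R * W) / 2.
  rewrite -(dot_toep_row v x 1 (leqnn nR)) mul1r -/z; lra.
apply: (@le_trans _ _ (\sum_(0 <= j < p) \sum_(0 <= i < nR) \sum_(0 <= k < T)
   (block v k j ^+ 2 * vat z i ^+ 2 / (2 * W) +
    W / 2 * vat x^T ((i + k) * p + j) ^+ 2))).
  apply: ler_sum => j _; apply: ler_sum => i _; apply: ler_sum => k _.
  rewrite mul1r; move: (vat z i) (block v k j) (vat x^T _) => a b c.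
  have -> : b ^+ 2 * a ^+ 2 / (2 * W) + W / 2 * c ^+ 2 =
      a * b * c + (a * b - W * c) ^+ 2 / (2 * W) by field; rewrite gt_eqF.
  by rewrite lerDl mulr_ge0 ?sqr_ge0// invr_ge0 mulr_ge0// ltW.
under eq_bigr do under eq_bigr do rewrite big_split/=.
under eq_bigr do rewrite big_split/=.
rewrite big_split/= [leRHS]mulrDl; apply: lerD.
  have -> : \sum_(0 <= j < p) \sum_(0 <= i < nR) \sum_(0 <= k < T)
      block v k j ^+ 2 * vat z i ^+ 2 / (2 * W) = dot v v * (dot z z / (2 * W)).
    rewrite -sum_block_sqr mulr_suml; apply: eq_bigr => j _.
    rewrite dot_vat exchange_big/= mulr_suml; apply: eq_bigr => k _.
    by rewrite -mulr_suml -mulr_sumr -mulrA.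
  rewrite invfM [dot z z * _]mulrCA [2^-1 * _]mulrC mulrA ler_wpM2r//.
  rewrite [dot z z / W]mulrC mulrA ler_piMl// ler_pdivrMr ?mul1r//.
under eq_bigr do under eq_bigr do rewrite -mulr_sumr.
under eq_bigr do rewrite -mulr_sumr.
rewrite -mulr_sumr [T%:R * W]mulrC -!mulrA ler_wpM2l ?(ltW W0)// mulrC ler_wpM2r//.
under eq_bigr do rewrite exchange_big/=.
rewrite exchange_big/=.
(* For fixed [k], the rows read distinct entries of [x]. *)
apply: (@le_trans _ _ (\sum_(0 <= k < T) dot x^T x^T)).
  apply: ler_sum => k _; apply: le_trans (sum_columns_le x (nR + k)).
  apply: ler_sum => j _; rewrite [leRHS](@big_cat_nat _ _ _ k)//= ?leq_addl//.
  have -> : \sum_(k <= c < nR + k) vat x^T (c * p + j) ^+ 2 =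
      \sum_(0 <= i < nR) vat x^T ((i + k) * p + j) ^+ 2.
    by rewrite -{1}[k]add0n big_addn addnK.
  rewrite lerDr.
  by apply: sumr_ge0 => c _; rewrite sqr_ge0.
by rewrite sumr_const_nat subn0 lerMn2r x1 orbT.
Qed.

(** Frequency, coordinate within a block, and choice of cosine or sine. The reversal T - 1 - q / p
    matches the order of the superdiagonals. *)
Definition phase_functional (h : 'I_(2 * T) * 'I_p * bool) : 'rV[R]_(T * p) :=
  \row_q (if (q %% p == h.1.2)%N then
    (if h.2 then cos else sin) (phase R T h.1.1 (T - 1 - q %/ p)) else 0).

Lemma vat_phase_functional h q : (q < T * p)%N -> vat (phase_functional h) q =
  if (q %% p == h.1.2)%N then
    (if h.2 then cos else sin) (phase R T h.1.1 (T - 1 - q %/ p)) else 0.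
Proof. by move=> qT; rewrite -[q]/(nat_of_ord (Ordinal qT)) vat_ord mxE. Qed.

Lemma dot_phase_functional h (u : 'rV[R]_(T * p)) :
  dot (phase_functional h) u = \sum_(0 <= c < T)
   (if h.2 then cos else sin) (phase R T h.1.1 (T - 1 - c)) * vat u (c * p + h.1.2).
Proof.
rewrite -(sum_residue (fun c => (if h.2 then cos else sin) (phase R T h.1.1 (T - 1 - c)))
  (vat u) T (ltn_ord h.1.2)) dot_vat.
by apply: eq_big_nat => q /andP[_ qT]; rewrite vat_phase_functional.
Qed.

Lemma dot_phase_functional_block v (h : 'I_(2 * T) * 'I_p * bool) :
  dot (phase_functional h) v =
  if h.2 then cosT T (block v ^~ h.1.2) T h.1.1
  else sinT T (block v ^~ h.1.2) T h.1.1.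
Proof.
rewrite dot_phase_functional big_nat_rev/=.
have -> : (if h.2 then cosT T (block v ^~ h.1.2) T h.1.1
  else sinT T (block v ^~ h.1.2) T h.1.1) =
  \sum_(0 <= c < T) block v c h.1.2 * (if h.2 then cos else sin) (phase R T h.1.1 c).
  by case: h.2.
apply: eq_big_nat => c /andP[_ cT].
by rewrite mulrC /block; congr (vat v (_ * p + _) * _ (phase R T _ _)); lia.
Qed.

Lemma dot_phase_functional_le h : dot (phase_functional h) (phase_functional h) <= T%:R.
Proof.
rewrite dot_phase_functional.
apply: (@le_trans _ _ (\sum_(0 <= c < T) 1)); last by rewrite sumr_const_nat subn0.
apply: ler_sum_nat => c /andP[_ cT].
have hp := ltn_ord h.1.2.
rewrite vat_phase_functional; last first.
  by have := leq_mul cT (leqnn p); rewrite mulSn; lia.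
rewrite modnMDl modn_small// eqxx divnMDl// divn_small// addn0 -expr2.
set t := phase _ _ _ _; have := cos2Dsin2 t.
by have := sqr_ge0 (cos t); have := sqr_ge0 (sin t); case: h.2; lra.
Qed.

Lemma toepnorm_le_functionals v (B : R) : 0 < B ->
  (forall h, `|dot (phase_functional h) v| <= B) ->
  toepnorm nR v <= 3 * Num.sqrt p%:R * B.
Proof.
move=> B0 vB; apply: toepnorm_le_phases => // m j mT jp.
have := vB (Ordinal mT, Ordinal jp, true).
have := vB (Ordinal mT, Ordinal jp, false).
by rewrite !dot_phase_functional_block.
Qed.

End Toeplitz.

(** * Codes for the sphere and the two chaining bounds *)

Section SphereCodes.
Variables (R : realType) (T p nR : nat).
Hypotheses (T_gt0 : (0 < T)%N) (p_gt0 : (0 < p)%N).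
Local Notation d := (T * p)%N.
Local Notation dist := (fun x y : 'rV[R]_d => toepnorm nR (x - y)).
Local Notation X := (@sphere R d).

Let T0 : (0 : R) < T%:R. Proof. by rewrite ltr0n. Qed.
Let p0 : (0 : R) < p%:R. Proof. by rewrite ltr0n. Qed.
Let d0 : (0 : R) < d%:R. Proof. by rewrite ltr0n muln_gt0 T_gt0 p_gt0. Qed.

Lemma sphere_dot x : X x -> dot x x = 1.
Proof.
move=> /= x1; rewrite -(@sqr_sqrtr _ (dot x x)) ?dotxx_ge0//.
by rewrite -enormE x1 expr1n.
Qed.

Lemma sphere_dist_le x y : X x -> X y -> dist x y <= 2 * Num.sqrt T%:R.
Proof.
move=> /sphere_dot x1 /sphere_dot y1.
have -> : 2 * Num.sqrt T%:R = Num.sqrt (T%:R * 4) :> R.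
  rewrite sqrtrM ?ler0n// mulrC; congr (_ * _).
  by rewrite (_ : 4 = 2 ^+ 2) ?sqrtr_sqr ?ger0_norm// -natrX.
apply: toepnorm_le_sqrt => //.
have := dotxx_ge0 (x - (-1) *: y).
by rewrite !(dotBr, dotBl, dotZl, dotZr) (dotC y x) x1 y1; lra.
Qed.

Let dist_refl x : dist x x = 0.
Proof. by rewrite /= subrr toepnorm0. Qed.

Lemma sphere_truncation_coded n : (4 * d <= 2 ^ n)%N ->
  coded dist X (2 ^ (2 ^ n)) (2 * d%:R * Num.sqrt T%:R / 2 ^+ n).
Proof.
have d_gt0 : (0 < d)%N by rewrite muln_gt0 T_gt0.
case: n => [|n] dn; first by move: dn; lia.
have sd0 : 0 < Num.sqrt (d%:R : R) by rewrite sqrtr_gt0.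
have sdE : Num.sqrt (d%:R : R) ^+ 2 = d%:R by rewrite sqr_sqrtr// ltW.
(* The l1 norm on the sphere is at most sqrt d, so 2^n grid steps suffice; here [n] is one less than
   the level, leaving half the bits for the [2 * d] overhead. *)
pose delta : R := Num.sqrt d%:R / 2 ^+ n.
have n0 : (0 : R) < 2 ^+ n by rewrite exprn_gt0.
have delta0 : 0 < delta by rewrite divr_gt0.
apply: (@coded_le _ _ _ _ (2 ^ (2 ^ n + 2 * d)) _ _ _ _ (lexx _)).
  by rewrite leq_exp2l//; move: dn; rewrite expnS; lia.
apply: (@truncation_coded _ _ _ _ _ delta) => //.
  move=> x /sphere_dot x1; rewrite natrX /delta mulrC divfK ?gt_eqF//.
  apply: (@le_trans _ _ (\sum_i (Num.sqrt d%:R * (x 0 i * x 0 i) +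
     (Num.sqrt d%:R)^-1) / 2)).
    apply: ler_sum => i _; rewrite -expr2 -real_normK ?num_real//.
    move: `|x 0 i| => a; have -> : (Num.sqrt d%:R * a ^+ 2 + (Num.sqrt d%:R)^-1) / 2 =
        a + (Num.sqrt d%:R * a - 1) ^+ 2 / (2 * Num.sqrt d%:R).
      by field; rewrite gt_eqF.
    by rewrite lerDl divr_ge0 ?sqr_ge0// mulr_ge0// ltW.
  rewrite -mulr_suml big_split/= -mulr_sumr -/(dot x x) x1 sumr_const card_ord.
  have -> : (Num.sqrt d%:R : R)^-1 *+ d = Num.sqrt d%:R.
    by rewrite -[LHS]mulr_natr -[X in _ * X]sdE expr2 mulKf ?gt_eqF.
  by rewrite mulr1 ler_pdivrMr//; lra.
move=> x y _ _ xy.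
have -> : 2 * d%:R * Num.sqrt T%:R / 2 ^+ n.+1 = Num.sqrt (T%:R * (d%:R * delta ^+ 2)).
  rewrite (sqrtrM _ (ltW T0)) (sqrtrM _ (ltW d0)) sqrtr_sqr ger0_norm ?(ltW delta0)//.
  rewrite /delta exprS -[in LHS]sdE; field.
  by rewrite gt_eqF.
apply: toepnorm_le_sqrt => //; first by rewrite mulr_gt0// exprn_gt0.
apply: (@le_trans _ _ (\sum_(i < d) delta ^+ 2)); last first.
  by rewrite sumr_const card_ord mulr_natl.
apply: ler_sum => i _; rewrite -expr2 -real_normK ?num_real// !mxE.
by rewrite lerXn2r ?nnegrE ?(ltW delta0)// xy.
Qed.

(** [l] bits hold one greedy symbol: 4d functionals with two signs, plus [None]. *)
Lemma sphere_greedy_coded n (l : nat) : (8 * d + 1 <= 2 ^ l)%N ->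
  coded dist X (2 ^ (2 ^ n)) (9 * Num.sqrt (d%:R * l%:R) / Num.sqrt (2 ^+ n)).
Proof.
move=> dl.
have d_gt0 : (0 < d)%N by rewrite muln_gt0 T_gt0.
have l_gt0 : (0 < l)%N by case: l dl => //; lia.
have l0 : (0 : R) < l%:R by rewrite ltr0n.
have s0 := sqrt2X_gt0 R n.
(* If not even one symbol fits, the constant code already meets the bound. *)
have [nl|ln] := ltnP (2 ^ n)%N l.
  exists (fun=> 0%N); split=> [x _|x y Xx Xy _]; first by rewrite expn_gt0.
  apply: (le_trans (sphere_dist_le Xx Xy)).
  rewrite ler_pdivlMr// -mulrA -sqrtrM ?ler0n//.
  apply: (@le_trans _ _ (2 * Num.sqrt (d%:R * l%:R))); last first.
    by have := sqrtr_ge0 (d%:R * l%:R : R); lra.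
  rewrite ler_wpM2l// ler_wsqrtr// ler_pM ?ler0n ?exprn_ge0//.
    by rewrite ler_nat leq_pmulr.
  by rewrite -natrX ler_nat ltnW.
pose m := (2 ^ n %/ l)%N.
have m_gt0 : (0 < m)%N by rewrite divn_gt0.
have m0 : (0 : R) < m%:R by rewrite ltr0n.
(* The threshold for which [m] steps exhaust the unit squared norm: m e^2 / T = 1. *)
pose e : R := Num.sqrt (T%:R / m%:R).
have e0 : 0 < e by rewrite sqrtr_gt0 divr_gt0.
have e2 : e ^+ 2 = T%:R / m%:R by rewrite sqr_sqrtr// divr_ge0// ltW.
have lm : (2 ^ n <= 2 * m * l)%N.
  have := divn_eq (2 ^ n) l; have := ltn_pmod (2 ^ n) l_gt0.
  rewrite -/m; move: (2 ^ n %% l)%N => r rl ->.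
  have : (l <= m * l)%N by rewrite leq_pmull.
  lia.
apply: (@coded_le _ _ _ _ ((#|{: 'I_(2 * T) * 'I_p * bool}| * 2).+1 ^ m) _
   (3 * Num.sqrt p%:R * (2 * e))).
- apply: (@leq_trans ((2 ^ l) ^ m)).
    rewrite leq_exp2r// !card_prod !card_ord card_bool.
    by apply: leq_trans dl; lia.
  by rewrite -expnM leq_exp2l// mulnC leq_trunc_div.
(* Squared, the claim is 36 d 2^n / m <= 81 d l; rounding in [m] costs a factor 2, giving 72 d l. *)
- rewrite ler_pdivlMr// -(@ler_pXn2r _ 2)// ?nnegrE ?mulr_ge0 ?sqrtr_ge0 ?(ltW e0)//.
  rewrite !exprMn sqr_sqrt2X e2 !sqr_sqrtr ?mulr_ge0 ?ler0n//.
  have : (2 ^+ n : R) / m%:R <= 2 * l%:R.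
    rewrite ler_pdivrMr// -natrX -!natrM ler_nat; lia.
  move=> h; have -> : 3 ^+ 2 * p%:R * (2 ^+ 2 * (T%:R / m%:R)) * 2 ^+ n =
     36 * d%:R * (2 ^+ n / m%:R) :> R by rewrite natrM; field; rewrite gt_eqF.
  apply: (@le_trans _ _ (36 * d%:R * (2 * l%:R))).
    by rewrite ler_wpM2l// mulr_ge0.
  have : (0 : R) <= d%:R * l%:R by rewrite mulr_ge0 ?ler0n.
  lra.
apply: (@greedy_coded _ _ _ (@phase_functional R T p) T%:R e) => //.
- exact: dot_phase_functional_le.
- move=> x /sphere_dot ->; rewrite e2.
  have -> : m%:R * (T%:R / m%:R / T%:R) = 1 :> R by field; rewrite !gt_eqF.
  by [].
- move=> x y _ _ xy; apply: toepnorm_le_functionals => //.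
  by rewrite mulr_gt0.
Qed.

Lemma gamma2_sphere_le_trivial :
  (gamma2 dist X <= (28 * (Num.sqrt T%:R * Num.sqrt d%:R))%:E)%E.
Proof.
have d_gt0 : (0 < d)%N by rewrite muln_gt0 T_gt0 p_gt0.
pose n := up_log 2 (4 * d).
have /andP[nl nr] : (2 ^ n.-1 < 4 * d <= 2 ^ n)%N by apply: up_log_bounds; lia.
have n_gt0 : (0 < n)%N by case: (n) nr => //; lia.
have sT := sqrtr_ge0 (T%:R : R); have sd0 : 0 < Num.sqrt (d%:R : R) by rewrite sqrtr_gt0.
have sdE : Num.sqrt (d%:R : R) ^+ 2 = d%:R by rewrite sqr_sqrtr// ltW.
have s0 := sqrt2X_gt0 R n; have sE := sqr_sqrt2X R n.
have U0 : 0 <= 2 * Num.sqrt T%:R :> R by rewrite mulr_ge0.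
have W0 : 0 <= 2 * d%:R * Num.sqrt T%:R :> R by rewrite !mulr_ge0.
(* Both thresholds coincide, so the middle range is empty. *)
have nn : (0 < n <= n)%N by rewrite n_gt0 leqnn.
apply: le_trans (gamma2_le_three_ranges dist_refl nn U0 (lexx 0) W0
  sphere_dist_le _ _) _.
- by move=> k; case: ltnP => //; rewrite andbF.
- move=> k nk; apply: sphere_truncation_coded; apply: leq_trans nr _.
  by rewrite leq_exp2l.
have nR1 : (2 ^+ n : R) <= 8 * d%:R.
  rewrite -natrX -natrM ler_nat -(prednK n_gt0) expnS; lia.
have nR2 : 4 * d%:R <= (2 ^+ n : R) by rewrite -natrX -natrM ler_nat.
have h1 : Num.sqrt (2 ^+ n) <= 3 * Num.sqrt d%:R :> R by nra.
have h2 : 2 * Num.sqrt d%:R <= Num.sqrt (2 ^+ n) :> R by nra.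
have h3 : d%:R / Num.sqrt (2 ^+ n) <= Num.sqrt d%:R / 2 :> R.
  by rewrite ler_pdivrMr//; nra.
rewrite lee_fin mulr0 addr0.
have -> : 4 * (2 * d%:R * Num.sqrt T%:R) / Num.sqrt (2 ^+ n) =
  8 * Num.sqrt T%:R * (d%:R / Num.sqrt (2 ^+ n)) :> R by ring.
have := ler_wpM2l sT h1; have := ler_wpM2l sT h3; lra.
Qed.

Lemma gamma2_sphere_le_chaining (k l : nat) :
  (4 * (T * T) <= 2 ^ k)%N -> (8 * d + 1 <= 2 ^ l)%N ->
  (gamma2 dist X <= (20 * Num.sqrt d%:R +
     9 * k%:R * Num.sqrt (d%:R * l%:R))%:E)%E.
Proof.
move=> Tk dl.
have d_gt0 : (0 < d)%N by rewrite muln_gt0 T_gt0 p_gt0.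
(* These thresholds make both outer sums of order sqrt d: at most 16 sqrt d and 4 sqrt d. Their
   ratio 2^n1 / 2^n0 stays below 4 T^2, which bounds the middle range by [k]. *)
pose n0 := up_log 2 (2 * p); pose n1 := up_log 2 (4 * d * T).
have p_le : (2 * p <= 4 * d * T)%N.
  have : (1 * p * 1 <= T * p * T)%N by rewrite !leq_mul.
  lia.
have /andP[n0l n0r] : (2 ^ n0.-1 < 2 * p <= 2 ^ n0)%N by apply: up_log_bounds; lia.
have /andP[n1l n1r] : (2 ^ n1.-1 < 4 * d * T <= 2 ^ n1)%N by apply: up_log_bounds; lia.
have n0_gt0 : (0 < n0)%N by case: (n0) n0r => // ; lia.
have n01 : (n0 <= n1)%N by exact: leq_up_log.
have n1_gt0 : (0 < n1)%N by exact: leq_trans n01.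
have sT0 : 0 < Num.sqrt (T%:R : R) by rewrite sqrtr_gt0.
have sp0 : 0 < Num.sqrt (p%:R : R) by rewrite sqrtr_gt0.
have sd0 : 0 < Num.sqrt (d%:R : R) by rewrite sqrtr_gt0.
have sTE : Num.sqrt (T%:R : R) ^+ 2 = T%:R by rewrite sqr_sqrtr// ltW.
have spE : Num.sqrt (p%:R : R) ^+ 2 = p%:R by rewrite sqr_sqrtr// ltW.
have sdE : Num.sqrt (d%:R : R) = Num.sqrt T%:R * Num.sqrt p%:R.
  by rewrite natrM sqrtrM// ltW.
have U0 : 0 <= 2 * Num.sqrt T%:R :> R by rewrite mulr_ge0.
have Q0 : 0 <= 9 * Num.sqrt (d%:R * l%:R) :> R by rewrite mulr_ge0.
have W0 : 0 <= 2 * d%:R * Num.sqrt T%:R :> R by rewrite !mulr_ge0.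
have nn : (0 < n0 <= n1)%N by rewrite n0_gt0.
apply: le_trans (gamma2_le_three_ranges dist_refl nn U0 Q0 W0
  sphere_dist_le _ _) _.
- by move=> n _; apply: sphere_greedy_coded.
- move=> n n1n; apply: sphere_truncation_coded.
  apply: (@leq_trans (2 ^ n1)); last by rewrite leq_exp2l.
  by apply: leq_trans n1r; rewrite leq_pmulr.
have kn : (n1 - n0 <= k)%N.
  rewrite leq_subLR -(@leq_exp2l 2)// expnD.
  rewrite -(prednK n1_gt0) expnS.
  apply: (@leq_trans (2 * (4 * d * T))); first by rewrite leq_mul2l ltnW.
  apply: leq_trans (leq_mul n0r Tk); nia.
have s0 := sqrt2X_gt0 R n0; have s0E := sqr_sqrt2X R n0.
have s1 := sqrt2X_gt0 R n1; have s1E := sqr_sqrt2X R n1.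
have r0 : (2 ^+ n0 : R) <= 4 * p%:R.
  rewrite -natrX -natrM ler_nat -(prednK n0_gt0) expnS; lia.
have r1 : 4 * d%:R * T%:R <= (2 ^+ n1 : R) by rewrite -natrX -!natrM ler_nat.
have h0 : Num.sqrt (2 ^+ n0) <= 2 * Num.sqrt p%:R :> R by nra.
have h1 : 2 * (Num.sqrt d%:R * Num.sqrt T%:R) <= Num.sqrt (2 ^+ n1) :> R.
  rewrite -(@ler_pXn2r _ 2)// ?nnegrE ?mulr_ge0 ?(ltW s1)//.
  rewrite s1E !exprMn sTE sqr_sqrtr ?ler0n//; move: r1; lra.
have h2 : d%:R * Num.sqrt T%:R / Num.sqrt (2 ^+ n1) <= Num.sqrt d%:R / 2 :> R.
  rewrite ler_pdivrMr// -{1}(@sqr_sqrtr _ (d%:R : R)) ?ler0n//.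
  have := ler_wpM2l (ltW sd0) h1; lra.
rewrite lee_fin.
have -> : 4 * (2 * d%:R * Num.sqrt T%:R) / Num.sqrt (2 ^+ n1) =
  8 * (d%:R * Num.sqrt T%:R / Num.sqrt (2 ^+ n1)) :> R by ring.
have h3 : (n1 - n0)%:R * (9 * Num.sqrt (d%:R * l%:R)) <=
    9 * k%:R * Num.sqrt (d%:R * l%:R) :> R.
  rewrite mulrA [9 * _]mulrC ler_wpM2r// ler_wpM2r// ler_nat//.
have := ler_wpM2l (ltW sT0) h0; rewrite [in leRHS]mulrCA -sdE; lra.
Qed.

End SphereCodes.

(** * From binary to natural logarithms, and the final bound *)

Lemma pow2_le_ln (R : realType) (a k b : nat) : (0 < b)%N ->
  (2 ^ k <= 2 ^ a * b)%N -> k%:R <= a%:R + 2 * ln (b%:R : R).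
Proof.
move=> b0 kab; have b1 : (1 : R) <= b%:R by rewrite ler1n.
have lnb := ln_ge0 b1.
have [ka|ak] := leqP k a.
  by have : (k%:R : R) <= a%:R; [rewrite ler_nat|lra].
have kb : (2 ^ (k - a) <= b)%N.
  by rewrite -(@leq_pmul2l (2 ^ a)) ?expn_gt0// -expnD subnKC// ltnW.
(* This crude form of ln 2 >= 1/2 follows from exp(-1/2) >= 1 - 1/2 and explains the factor 2. *)
have e2 : expR (2^-1 : R) <= 2.
  rewrite -[2^-1]opprK expRN -[leRHS]invrK lef_pV2 ?posrE ?expR_gt0 ?invr_gt0//.
  by have := expR_ge1Dx (- 2^-1 : R); lra.
have : expR ((k - a)%:R * 2^-1 : R) <= b%:R.
  rewrite expRM_natl; apply: (@le_trans _ _ (2 ^+ (k - a))).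
    by rewrite lerXn2r ?nnegrE ?expR_ge0.
  by rewrite -natrX ler_nat.
rewrite -ler_ln ?posrE ?expR_gt0 ?ltr0n// expRK natrB ?(ltnW ak)//.
by lra.
Qed.

Theorem proposition7 (R : realType) :
  exists C : R, 0 < C /\
  forall T p nR : nat, (1 <= T)%N -> (1 <= p)%N -> (1 <= nR)%N ->
    (gamma2 (fun x y : 'rV[R]_(T * p) => toepnorm nR (x - y)%R) (@sphere R (T * p))
      <= ((C * Num.sqrt (T%:R * @ptilde R T p))%R)%:E)%E.
Proof.
(* 128 = 20 + 9 * 4 * 3, from k <= 4 [LT], sqrt l <= 3 [LP] and [LP * LT] >= 1. *)
exists 128; split=> // T p nR T_gt0 p_gt0 _.
have T1 : (1 : R) <= T%:R by rewrite ler1n.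
have d_gt0 : (0 < T * p)%N by rewrite muln_gt0 T_gt0 p_gt0.
have d1 : (1 : R) <= (T * p)%:R by rewrite ler1n.
have p0 : (0 : R) <= p%:R by [].
pose LT := ln (expR 1 * T%:R : R); pose LP := ln (expR 1 * (T * p)%:R : R).
have LTE : LT = 1 + ln T%:R.
  by rewrite /LT lnM ?posrE ?expR_gt0 ?ltr0n// expRK.
have LPE : LP = 1 + ln (T * p)%:R.
  by rewrite /LP lnM ?posrE ?expR_gt0 ?ltr0n// expRK.
have LT1 : 1 <= LT by rewrite LTE lerDl ln_ge0.
have LP1 : 1 <= LP by rewrite LPE lerDl ln_ge0.
have sd := sqrtr_ge0 ((T * p)%:R : R).
rewrite /ptilde -/LT -/LP; case: (leP T%:R (LP ^+ 2 * LT ^+ 2)) => _.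
  apply: (le_trans (gamma2_sphere_le_trivial R nR T_gt0 p_gt0)); rewrite lee_fin.
  have -> : T%:R * (p%:R * T%:R) = T%:R * (T * p)%:R :> R by rewrite natrM; ring.
  rewrite sqrtrM ?ler0n//; apply: ler_wpM2r; last by rewrite ler_nat.
  by rewrite mulr_ge0.
(* The 16 absorbs the extra symbol: 8 d + 1 <= 16 d. *)
pose k := up_log 2 (4 * (T * T)); pose l := up_log 2 (16 * (T * p)).
have TT : (0 < T * T)%N by rewrite muln_gt0 T_gt0.
have /andP[kl kr] : (2 ^ k.-1 < 4 * (T * T) <= 2 ^ k)%N by apply: up_log_bounds; lia.
have /andP[ll lr] : (2 ^ l.-1 < 16 * (T * p) <= 2 ^ l)%N by apply: up_log_bounds; lia.
have kT : k%:R <= 4 * LT :> R.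
  have : (2 ^ k <= 2 ^ 3 * (T * T))%N.
    by case: (k) kl => [|k']; rewrite ?expnS/=; lia.
  move/(pow2_le_ln R TT); rewrite natrM lnM ?posrE ?ltr0n// LTE.
  have := ln_ge0 T1; lra.
have lP : l%:R <= 5 * LP :> R.
  have : (2 ^ l <= 2 ^ 5 * (T * p))%N.
    by case: (l) ll => [|l']; rewrite ?expnS/=; lia.
  move/(pow2_le_ln R d_gt0); rewrite LPE.
  have := ln_ge0 d1; lra.
have dl : (8 * (T * p) + 1 <= 2 ^ l)%N by lia.
apply: (le_trans (gamma2_sphere_le_chaining R nR T_gt0 p_gt0 kr dl)).
rewrite lee_fin.
have -> : Num.sqrt (T%:R * (p%:R * (LP ^+ 2 * LT ^+ 2))) =
    Num.sqrt (T * p)%:R * (LP * LT).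
  rewrite mulrA -natrM sqrtrM ?ler0n// -exprMn sqrtr_sqr ger0_norm//.
  by rewrite mulr_ge0//; lra.
have sl : Num.sqrt (l%:R : R) <= 3 * LP.
  rewrite -[3 * LP]ger0_norm; last lra.
  by rewrite -sqrtr_sqr ler_wsqrtr//; nra.
rewrite sqrtrM ?ler0n//.
have h : k%:R * Num.sqrt l%:R <= 4 * LT * (3 * LP) by rewrite ler_pM.
have h' : 20 + 9 * (k%:R * Num.sqrt l%:R) <= 128 * (LP * LT) by nra.
have := ler_wpM2l sd h'; lra.
Qed.
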